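(* Let $M$ be a countable locally finite structure such that algebraic closures of finite subsets of $M$ are finite, and let $G=\mathrm{Aut}(M)$. Then for every $n\geq 1$ and every $n$-tuple $\bar f$ in $G$, at least one of the following holds: \begin{itemize} \item $\langle\bar f\rangle$ is precompact, or \item $\langle\bar f\rangle$ is discrete, or \item the topological $n$-similarity class of $\bar f$ is meager in $G^n$. \end{itemize}
   Context: A structure is a set with relations and functions; it is locally finite if all its finitely generated substructures are finite. $\mathrm{Aut}(M)$ carries the pointwise convergence topology ($M$ discrete), making it a Polish group. For finite $A\subseteq M$, $\mathrm{Aut}_A(M)$ is the pointwise stabilizer of $A$ in $\mathrm{Aut}(M)$, and the algebraic closure of $A$ is the set of all elements of $M$ whose orbit under the evaluation action of $\mathrm{Aut}_A(M)$ is finite. For an $n$-tuple $\bar f=(f_1,\ldots,f_n)$ in a topological group $G$, $\langle\bar f\rangle$ is the subgroup generated by $\{f_1,\ldots,f_n\}$. A subgroup is precompact if its closure in $G$ is compact, and discrete if its subspace topology is discrete. The topological $n$-similarity class of $\bar f$ is the set of all $\bar g=(g_1,\ldots,g_n)\in G^n$ such that the map $f_i\mapsto g_i$ extends (necessarily uniquely) to a bi-continuous group isomorphism between $\langle\bar f\rangle$ and $\langle\bar g\rangle$, taken with the subspace topologies. *)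

(* Defs.v *)
From HB Require Import structures.
From mathcomp Require Import all_boot all_order all_algebra.
From mathcomp Require Import all_classical all_reals all_analysis.

Set Implicit Arguments.
Unset Strict Implicit.
Unset Printing Implicit Defensive.

Local Open Scope classical_set_scope.
Local Open Scope group_scope.

HB.mixin Record Group_isTopologicalGroup G & Topological G & Group G := {
  mulg_continuous : continuous (fun x : G * G => x.1 * x.2);
  invg_continuous : continuous (fun x : G => x^-1)
}.

#[short(type="topologicalGroupType")]
HB.structure Definition TopologicalGroup :=
  {G of Topological G & Group G & Group_isTopologicalGroup G}.

Definition subgroup (G : groupType) : set (set G) :=
  [set H | [/\ H 1, forall x y, H x -> H y -> H (x * y)
             & forall x, H x -> H x^-1]].

Definition generated (G : groupType) (n : nat) (f : 'I_n -> G) : set G :=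
  smallest (@subgroup G) (range f).

(* [U] ranges over the subsets of the type of elements of [A], whose canonical
   topology is the subspace topology. *)
Definition discrete_subset (T : topologicalType) (A : set T) :=
  forall U : set A, open U.

Definition nowhere_dense (T : topologicalType) (A : set T) :=
  interior (closure A) = set0.

Definition meager (T : topologicalType) (A : set T) :=
  exists2 F : nat -> set T,
    (forall i, nowhere_dense (F i)) & A `<=` \bigcup_i F i.

(* [phi] restricts to a bicontinuous isomorphism <f> -> <g>, and [psi] to its
   inverse; values outside these subgroups are irrelevant. *)
Definition similarity_class (G : topologicalGroupType) (n : nat)
    (f : 'I_n -> G) : set {ptws 'I_n -> G} :=
  [set g | exists phi psi : G -> G,
    (forall i, phi (f i) = g i) /\
    [/\ set_bij (generated f) (generated g) phi,
        {in generated f, cancel phi psi},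
        {in generated f &, {morph phi : x y / x * y}},
        {within generated f, continuous phi}
      & {within generated g, continuous psi}]].

Record structure := Structure {
  carrier :> Type;
  rel_symbol : Type;
  rel_arity : rel_symbol -> nat;
  rel_interp : forall R, set ('I_(rel_arity R) -> carrier);
  fun_symbol : Type;
  fun_arity : fun_symbol -> nat;
  fun_interp : forall F, ('I_(fun_arity F) -> carrier) -> carrier
}.

Definition substructure (M : structure) : set (set M) :=
  [set A | forall F (x : 'I_(fun_arity F) -> M),
    (forall i, A (x i)) -> A (fun_interp x)].

Definition locally_finite (M : structure) :=
  forall A : set M, finite_set A -> finite_set (smallest (@substructure M) A).

(* [{classic M}] is [M] with the choice structure that topological spaces
   require. *)
Definition self_maps (M : structure) :=
  {ptws M -> discrete_topology {classic M}}.

Definition automorphism (M : structure) : set (self_maps M) :=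
  [set s : M -> M | [/\ bijective s,
    forall R (x : 'I_(rel_arity R) -> M), rel_interp (s \o x) <-> rel_interp x
  & forall F (x : 'I_(fun_arity F) -> M),
      s (fun_interp x) = fun_interp (s \o x)]].

Definition Aut (M : structure) : Type := set_type (@automorphism M).

HB.instance Definition _ (M : structure) :=
  SubChoice.copy (Aut M) (set_type (@automorphism M)).

Definition aut_fun (M : structure) (s : Aut M) : M -> M := \val s.
Coercion aut_fun : Aut >-> Funclass.

(* The subspace topology inherited from [self_maps M]. *)
HB.instance Definition _ (M : structure) :=
  Topological.copy (Aut M) (set_type (@automorphism M)).

Lemma aut_inj (M : structure) (s t : Aut M) : s =1 t -> s = t.
Proof. by move=> st; apply/val_inj/funext. Qed.

Definition mk_aut (M : structure) (s : self_maps M) (sA : automorphism s) :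
  Aut M := @exist _ (fun t => t \in @automorphism M) s (mem_set sA).

Lemma autP (M : structure) (s : Aut M) : automorphism (s : self_maps M).
Proof. exact: set_mem (valP s). Qed.

Lemma automorphism_id (M : structure) : automorphism (idfun : self_maps M).
Proof. by split => //; exists idfun. Qed.

Definition aut_one (M : structure) : Aut M := mk_aut (automorphism_id M).

Lemma automorphism_comp (M : structure) (s t : Aut M) :
  automorphism (s \o t : self_maps M).
Proof.
have [sb sR sF] := autP s; have [tb tR tF] := autP t.
split=> [|R x|F x].
- case: sb => s' sK Ks; case: tb => t' tK Kt.
  by exists (t' \o s'); [exact: (can_comp sK tK) | exact: (can_comp Kt Ks)].
- exact: iff_trans (sR _ (t \o x)) (tR _ x).
- by rewrite /= tF sF.
Qed.

Definition aut_mul (M : structure) (s t : Aut M) : Aut M :=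
  mk_aut (automorphism_comp s t).

Lemma aut_inv_exists (M : structure) (s : Aut M) :
  exists t : Aut M, cancel s t /\ cancel t s.
Proof.
have [[t sK tK] sR sF] := autP s.
have sc k (x : 'I_k -> M) : s \o (t \o x) = x.
  by apply/funext => i; exact: tK.
suff tA : automorphism (t : self_maps M) by exists (mk_aut tA).
split=> [|R x|F x].
- by exists s.
- by apply: iff_sym; rewrite -[X in rel_interp X <-> _](sc _ x); exact: sR.
- by rewrite -{1}(sc _ x) -sF sK.
Qed.

Definition aut_inv (M : structure) (s : Aut M) : Aut M :=
  projT1 (cid (aut_inv_exists s)).

Lemma aut_invK (M : structure) (s : Aut M) :
  cancel s (aut_inv s) /\ cancel (aut_inv s) s.
Proof. exact: projT2 (cid (aut_inv_exists s)). Qed.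

Lemma aut_mulA (M : structure) : associative (@aut_mul M).
Proof. by move=> s t u; apply: aut_inj. Qed.

Lemma aut_mul1 (M : structure) : left_id (aut_one M) (@aut_mul M).
Proof. by move=> s; apply: aut_inj. Qed.

Lemma aut_1mul (M : structure) : right_id (aut_one M) (@aut_mul M).
Proof. by move=> s; apply: aut_inj. Qed.

Lemma aut_mulV (M : structure) :
  left_inverse (aut_one M) (@aut_inv M) (@aut_mul M).
Proof. by move=> s; apply: aut_inj => x; exact: (aut_invK s).1. Qed.

Lemma aut_Vmul (M : structure) :
  right_inverse (aut_one M) (@aut_inv M) (@aut_mul M).
Proof. by move=> s; apply: aut_inj => x; exact: (aut_invK s).2. Qed.

HB.instance Definition _ (M : structure) := isGroup.Build (Aut M)
  (@aut_mulA M) (@aut_mul1 M) (@aut_1mul M) (@aut_mulV M) (@aut_Vmul M).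

Lemma aut_eval_nbhs (M : structure) (s : Aut M) (a : M) :
  nbhs s [set t : Aut M | t a = s a].
Proof.
have /= ec :
    continuous ((fun f : self_maps M => f a) \o (val : Aut M -> self_maps M)).
  move=> t; apply: continuous_comp.
    exact: (@initial_continuous (set_type (@automorphism M)) _ set_val).
  exact: (@proj_continuous {classic M} (fun=> discrete_topology {classic M}) a).
apply: (ec s [set x | x = s a]).
exact: (@discrete_set1 (discrete_topology {classic M})).
Qed.

Lemma aut_cvgP (M : structure) (F : set_system (Aut M)) (s : Aut M) :
  Filter F -> (forall a, F [set t : Aut M | t a = s a]) -> F --> s.
Proof.
move=> FF Fs U [_ [[W oW <-] Ws WU]]; apply: (filterS WU).
have Wn : nbhs (val s : self_maps M) W by apply: open_nbhs_nbhs.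
pose G : set_system (self_maps M) := [set V | F (set_val @^-1` V)].
have FG : Filter G by exact: (@fmap_filter _ _ set_val).
suff : G --> (val s : self_maps M) by apply.
apply/cvg_sup => a V [_ [[B oB <-] Bs BV]].
apply: (@filterS _ G _ _ _ BV).
apply: (@filterS _ F _ _ _ _ (Fs a)) => t ta.
suff : B (t a) by [].
by rewrite (ta : t a = s a).
Qed.

Lemma aut_mul_continuous (M : structure) :
  continuous (fun st : Aut M * Aut M => st.1 * st.2).
Proof.
case=> s t; move: s t => /= s t; apply: aut_cvgP => a.
pose s0 : Aut M := s; pose t0 : Aut M := t.
exists ([set s' : Aut M | s' (t0 a) = s0 (t0 a)],
        [set t' : Aut M | t' a = t0 a]).
  by split; exact: aut_eval_nbhs.
by case=> s' t' [/= ss' tt']; change (aut_fun s' (aut_fun t' a) = s0 (t0 a));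
  rewrite tt' ss'.
Qed.

Lemma aut_inv_continuous (M : structure) :
  continuous (fun s : Aut M => s^-1).
Proof.
move=> s; apply: aut_cvgP => [|a]; first exact: (@fmap_filter _ _ _ _ (nbhs_filter s)).
have := aut_eval_nbhs s (aut_inv s a).
rewrite (aut_invK s).2; apply: filterS => t ta.
suff : aut_inv t a = aut_inv s a by [].
by rewrite -[in LHS]ta (aut_invK t).1.
Qed.

HB.instance Definition _ (M : structure) :=
  Group_isTopologicalGroup.Build (Aut M)
    (@aut_mul_continuous M) (@aut_inv_continuous M).

Definition pointwise_stabilizer (M : structure) (A : set M) : set (Aut M) :=
  [set s | forall a, A a -> s a = a].

Definition acl (M : structure) (A : set M) : set M :=
  [set x | finite_set [set s x | s in pointwise_stabilizer A]].

(* Main.v *)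
Require Import Defs.
From mathcomp Require Import all_boot all_order all_algebra.
From mathcomp Require Import all_classical all_reals all_analysis.

Set Implicit Arguments.
Unset Strict Implicit.
Unset Printing Implicit Defensive.

Local Open Scope classical_set_scope.
Local Open Scope group_scope.

(** Assume that <f> is neither precompact nor discrete.  Two facts about f are
    inherited by every g in its similarity class.

    If every orbit of <f> on M were finite, then <f> would be precompact
    ([precompact_generated]); so some orbit of <f> is infinite, and since the
    isomorphism between <f> and <g> is bicontinuous, some orbit of <g> is
    infinite too ([controls_finite_orbit]).

    As <f> is not discrete, every finite set of points is fixed by the value
    at f of some nonempty reduced word ([reduced_stabilizing_word]).  Choosing
    for W k a word that fixes the images, under all words v of length at most k,
    of the first points of an enumeration of M, one makes the conjugates
    v^-1 (W k) v with |v| <= k tend to 1 in <f> as k grows, uniformly in v;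
    hence they tend to 1 in <g> as well ([similarity_controls]).  The class is
    therefore covered by the countably many sets [almost_fixing W a K] of
    tuples g for which a has an infinite orbit and W k fixes the image of a
    under v for all k >= K and |v| <= k.

    Each of these sets is nowhere dense ([nowhere_dense_almost_fixing]).  The
    fixing condition is closed, so otherwise it would hold for all extensions
    of a finite condition satisfied by some g for which a has an infinite
    orbit: the g i are prescribed on a finite set B, which can be taken
    algebraically closed.  A walk from a whose steps are all prescribed stays
    in a finite set, so some walk v from a reaches a point y at which a further
    step is not prescribed ([exit_path]).  As y is not
    algebraic over the points at which that step is prescribed, its image can
    take infinitely many values, and one can choose a value at which again only
    the letter leading back is prescribed ([fresh_step]).  Hence from y on
    all steps along a reduced word can be chosen fresh ([free_path]), and a
    reduced word read from there does not return to its starting point unless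
    its first step goes back towards y.  That obstacle is avoided by replacing
    the word by its inverse or by prolonging v by one more letter
    ([reduced_escape]).  So some extension moves the end of a walk of bounded
    length by any given nonempty reduced word ([moving_extension]),
    in contradiction with the fixing condition for W k with k large. *)

(** * Finiteness of images *)

Lemma finite_image_fibers (I X Y : Type) (S : set I) (p : I -> X) (q : I -> Y) :
  finite_set (p @` S) ->
  (forall i, S i -> finite_set (q @` [set j | S j /\ p j = p i])) ->
  finite_set (q @` S).
Proof.
move=> pfin qfin.
apply: (@sub_finite_set _ _
  (\bigcup_(x in p @` S) (q @` [set j | S j /\ p j = x]))).
  by move=> _ [i Si <-]; exists (p i); [exists i | exists i].
by apply: bigcup_finite => // _ [i Si <-]; exact: qfin.
Qed.

(** The elements of S fall into finitely many classes according to their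
    restriction to A, because each point of A has finitely many images. *)
Lemma finite_image_agreement (I T X Y : Type) (S : set I) (e : I -> T -> X)
    (q : I -> Y) (A : set T) :
  finite_set A -> (forall a, A a -> finite_set [set e i a | i in S]) ->
  (forall i, S i ->
    finite_set (q @` [set j | S j /\ forall a, A a -> e j a = e i a])) ->
  finite_set (q @` S).
Proof.
move=> /(@finite_seqP {classic T})[s ->].
elim: s S => [|b s IHs] S efin qfin.
  have [->|/set0P[i Si]] := eqVneq S set0; first by rewrite image_set0.
  apply: sub_finite_set (qfin i Si); apply: image_subset => j Sj.
  by split=> // a; rewrite /= in_nil.
apply: (@finite_image_fibers _ _ _ _ (e^~ b)).
  by apply: efin; rewrite /= mem_head.
move=> i Si; apply: IHs => [a sa|k [Sk ki]].
  apply: sub_finite_set (efin a _); last by rewrite /= inE [_ \in s]sa orbT.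
  by apply: image_subset => j [].
apply: sub_finite_set (qfin k Sk); apply: image_subset => j [[Sj ji] jk].
by split=> // a /=; rewrite inE => /orP[/eqP->|/jk//]; rewrite ji ki.
Qed.

(** * Words and reduced words *)

(** (i, true) stands for the i-th generator and (i, false) for its inverse. *)
Notation letter n := ('I_n * bool)%type.

Section Words.
Context {n : nat}.
Implicit Types (l : letter n) (u v w : seq (letter n)).

Definition letter_inv l : letter n := (l.1, ~~ l.2).

Definition word_inv w := rev (map letter_inv w).

Definition reduced w := sorted (fun k l => l != letter_inv k) w.

Definition letter_val (G : groupType) (h : 'I_n -> G) l : G :=
  if l.2 then h l.1 else (h l.1)^-1.

(** The head of the word acts first, so that words can be read as walks. *)
Fixpoint word_val (G : groupType) (h : 'I_n -> G) w : G :=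
  if w is l :: w' then word_val h w' * letter_val h l else 1.

Lemma letter_invK : involutive letter_inv.
Proof. by case=> i b; rewrite /letter_inv /= negbK. Qed.

Lemma letter_inv_neq l : letter_inv l != l.
Proof. by case: l => i []; apply/eqP => -[]. Qed.

Lemma letter_inv_eq k l : (letter_inv k == l) = (k == letter_inv l).
Proof. by rewrite (can2_eq letter_invK letter_invK). Qed.

Lemma word_val_cat (G : groupType) (h : 'I_n -> G) u v :
  word_val h (u ++ v) = word_val h v * word_val h u.
Proof. by elim: u => [|l u IHu] /=; rewrite ?mulg1// IHu mulgA. Qed.

Lemma letter_val_inv (G : groupType) (h : 'I_n -> G) l :
  letter_val h (letter_inv l) = (letter_val h l)^-1.
Proof. by case: l => i []; rewrite /letter_val //= invgK. Qed.

Lemma word_val_inv (G : groupType) (h : 'I_n -> G) w :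
  word_val h (word_inv w) = (word_val h w)^-1.
Proof.
elim: w => [|l w IHw] /=; first by rewrite invg1.
rewrite /word_inv /= rev_cons -cats1 word_val_cat IHw /= mul1g.
by rewrite letter_val_inv invgM.
Qed.

Lemma reduced_inv w : reduced w -> reduced (word_inv w).
Proof.
rewrite /reduced /word_inv rev_sorted sorted_map; apply: sub_sorted => k l /=.
by rewrite letter_invK eq_sym.
Qed.

Lemma reduced_word_exists (G : groupType) (h : 'I_n -> G) w :
  exists2 w', reduced w' & word_val h w' = word_val h w.
Proof.
elim: w => [|l w [w' rw' /= <-]]; first by exists [::].
case: w' rw' => [|k w'] /= rw'; first by exists [:: l].
have [kE|kl] := eqVneq k (letter_inv l).
  exists w'; first exact: path_sorted rw'.
  by rewrite kE letter_val_inv mulgVK.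
by exists [:: l, k & w'] => //=; rewrite /reduced /= kl.
Qed.

Lemma generatedP (G : groupType) (h : 'I_n -> G) x :
  generated h x <-> exists w, x = word_val h w.
Proof.
split=> [|[w ->]].
  move: x; apply: smallest_sub => [|_ [i _ <-]]; last first.
    by exists [:: (i, true)]; rewrite /= mul1g.
  split=> [|_ _ [u ->] [v ->]|_ [u ->]]; first by exists [::].
    by exists (v ++ u); rewrite word_val_cat.
  by exists (word_inv u); rewrite word_val_inv.
move=> H [[H1 HM HV] fH]; elim: w => //= l w IHw; apply: HM => //.
by case: l => i [] /=; [|apply: HV]; apply: fH; exists i.
Qed.

Lemma generated1 (G : groupType) (h : 'I_n -> G) : generated h 1.
Proof. by apply/generatedP; exists [::]. Qed.

Lemma generatedM (G : groupType) (h : 'I_n -> G) x y :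
  generated h x -> generated h y -> generated h (x * y).
Proof.
move=> /generatedP[u ->] /generatedP[v ->]; apply/generatedP; exists (v ++ u).
by rewrite word_val_cat.
Qed.

Lemma generatedV (G : groupType) (h : 'I_n -> G) x :
  generated h x -> generated h x^-1.
Proof.
move=> /generatedP[u ->]; apply/generatedP; exists (word_inv u).
by rewrite word_val_inv.
Qed.

(** If w or its inverse does not start by undoing l, then u is empty.
    Otherwise w starts with the inverse of l and ends with l; a reduced word in
    the letters l and l^-1 alone is a power of one letter and cannot do this, so
    w contains a letter with another index, which is then used to prolong l. *)
Lemma reduced_escape w l : reduced w -> w != [::] ->
  exists u k w', [/\ reduced (l :: u), (size u <= 1)%N, reduced (k :: w'),
    k :: w' = w \/ k :: w' = word_inv w & k != letter_inv (last l u)].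
Proof.
case: w => // c w rw _.
have [cl|cl] := eqVneq c (letter_inv l); last first.
  by exists [::], c, w; split=> //; left.
have [dl|dl] := eqVneq (last c w) l; last first.
  have := reduced_inv rw.
  rewrite /word_inv [c :: w]lastI map_rcons rev_rcons => ri.
  exists [::], (letter_inv (last c w)), (rev (map letter_inv (belast c w))).
  by split=> //; [right | rewrite /= letter_inv_eq letter_invK].
have [/hasP[k _ kl]|] := boolP (has (fun k => k.1 != l.1) w).
  exists [:: k], c, w; split=> //=; first 1 last.
  - by left.
  - by rewrite cl; apply: contra_neq kl => /(can_inj letter_invK) ->.
  by rewrite /reduced /= andbT; apply: contra_neq kl => ->.
move=> /hasPn same; exfalso; move: dl.
suff -> : last c w = c.
  by rewrite cl => /eqP; rewrite (negPf (letter_inv_neq l)).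
have same_index k : k \in w -> k.1 = c.1.
  move=> kw; rewrite cl; apply/eqP.
  by rewrite -[_ == _]negbK same// inE kw orbT.
elim: w rw same_index {same} => //= k w IHw /andP[kc rw] same.
have kE : k = c.
  have := same k (mem_head _ _); move: kc {IHw same rw}.
  by case: k c {cl} => i [] [j []] //= + E; rewrite /letter_inv E //= eqxx.
rewrite kE in rw *; apply: IHw => // m mw; apply: same.
by rewrite inE mw orbT.
Qed.

Lemma finite_short_words k :
  finite_set [set v : seq (letter n) | (size v <= k)%N].
Proof.
pose T : finType := {j : 'I_k.+1 & j.-tuple (letter n)}.
have fT : finite_set [set: T] by exact: finite_finset.
apply: sub_finite_set (finite_image (fun t : T => tval (tagged t)) fT) => v vk.
pose j : 'I_k.+1 := Ordinal (vk : (size v < k.+1)%N).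
by exists (existT (fun i : 'I_k.+1 => i.-tuple (letter n)) j (in_tuple v)).
Qed.

End Words.

(** * Automorphisms and algebraic closure *)

Section Automorphisms.
Context {M : structure}.
Implicit Types (s t : Aut M) (x y a : M) (A B : set M).

Lemma autME s t x : aut_fun (s * t) x = s (t x). Proof. by []. Qed.

Lemma autK s : cancel s (aut_fun s^-1). Proof. exact: (aut_invK s).1. Qed.

Lemma autVK s : cancel (aut_fun s^-1) s. Proof. exact: (aut_invK s).2. Qed.

Lemma pointwise_stabilizerV A s :
  pointwise_stabilizer A s -> pointwise_stabilizer A s^-1.
Proof. by move=> As x Ax; rewrite -{1}(As x Ax) autK. Qed.

Lemma sub_acl A : A `<=` acl A.
Proof.
move=> x Ax; apply: sub_finite_set (finite_set1 x) => _ [s As <-].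
exact: As.
Qed.

(** The finitely many points of acl A have finite orbits over A, so the
    automorphisms over acl A form a subgroup of finite index in those over A,
    and finite orbits under the former yield finite orbits under the latter. *)
Lemma acl_idem A : finite_set (acl A) -> acl (acl A) `<=` acl A.
Proof.
move=> fA x clx.
apply: (@finite_image_agreement _ _ _ _ _ (fun s y => s y) _ _ fA) => // s As.
apply: sub_finite_set (finite_image s clx) => _ [t [At ts] <-].
exists (aut_fun (s^-1 * t) x); last by rewrite autME autVK.
exists (s^-1 * t) => // y cly; rewrite autME ts// autK//.
Qed.

Lemma acl_image s A : acl (s @` A) `<=` s @` acl A.
Proof.
move=> x clx; exists (aut_fun s^-1 x); last exact: autVK.
apply: sub_finite_set (finite_image (aut_fun s^-1) clx) => _ [t At <-].
exists (aut_fun (s * t * s^-1) x); last by rewrite !autME autK.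
exists (s * t * s^-1) => // _ [y Ay <-].
by rewrite !autME autK At.
Qed.

End Automorphisms.

Definition finite_acl (M : structure) :=
  forall A : set M, finite_set A -> finite_set (acl A).

(** * Finite conditions and free walks *)

Section Conditions.
Context {M : structure} {n : nat}.
Implicit Types (h g : 'I_n -> Aut M) (D : 'I_n -> set M) (l : letter n).

(** A finite condition on tuples of automorphisms is encoded by a tuple h that
    satisfies it together with the finite sets D i on which h i is prescribed;
    [agree D h] is the basic open set of the tuples satisfying the condition. *)
Definition agree D h g := forall i x, D i x -> g i x = h i x.

(** The points at which the condition prescribes the step along l: for an
    inverse letter they are the images of the prescribed arguments. *)
Definition dom h D l : set M := if l.2 then D l.1 else h l.1 @` D l.1.

Definition step h l (x : M) : M := aut_fun (letter_val h l) x.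

Definition walk h w (x : M) : M := aut_fun (word_val h w) x.

Lemma walk_cons h l w x : walk h (l :: w) x = walk h w (step h l x).
Proof. by []. Qed.

Lemma walk_cat h u v x : walk h (u ++ v) x = walk h v (walk h u x).
Proof. by rewrite /walk word_val_cat. Qed.

Lemma walk_inv h w : cancel (walk h w) (walk h (word_inv w)).
Proof. by move=> x; rewrite /walk word_val_inv autK. Qed.

Lemma walk_invK h w : cancel (walk h (word_inv w)) (walk h w).
Proof. by move=> x; rewrite /walk word_val_inv autVK. Qed.

Lemma agree_trans D D' h g k : (forall i, D i `<=` D' i) ->
  agree D h g -> agree D' g k -> agree D h k.
Proof. by move=> DD' hg gk i x Dx; rewrite gk ?hg//; exact: DD'. Qed.

Lemma dom_eq h g D D' l : D l.1 = D' l.1 -> h l.1 = g l.1 ->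
  dom h D l = dom g D' l.
Proof. by rewrite /dom => -> ->. Qed.

Lemma finite_dom h D l : (forall i, finite_set (D i)) -> finite_set (dom h D l).
Proof. by rewrite /dom => fD; case: ifP => _ //; exact: finite_image. Qed.

Lemma agree_step h g D l x : agree D h g -> dom h D l x ->
  step g l x = step h l x.
Proof.
rewrite /step /letter_val /dom => hg.
case: l.2 => [|[y Dy <-]]; first exact: hg.
by rewrite autK -(hg _ _ Dy) autK.
Qed.

(** Composing the automorphism of l with the automorphisms that fix the domain
    of l pointwise gives the same prescribed values and, y not being algebraic
    over that domain, infinitely many values at y.  Only finitely many values
    must be avoided: those in X, those algebraic over the old domain of some
    letter, and those algebraic over the new domain of l, which is that domain
    with y added.  The letter opposite to l is excluded since its new domain
    contains the chosen value. *)
Lemma fresh_step h D l y (X : set M) :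
  finite_acl M -> (forall i, finite_set (D i)) -> finite_set X ->
  ~ acl (dom h D l) y ->
  exists h' D',
    [/\ forall i, finite_set (D' i), forall i, D i `<=` D' i,
        agree D h h', dom h' D' l y & ~ X (step h' l y)] /\
    forall k, k != letter_inv l -> ~ acl (dom h' D' k) (step h' l y).
Proof.
move=> facl fD fX ncl.
pose E := dom h D l; have fE : finite_set E by exact: finite_dom.
pose Z := X `|` acl (y |` E) `|` \bigcup_(k in [set: letter n]) acl (dom h D k).
have fZ : finite_set Z.
  rewrite !finite_setU; split; [split=> //|].
    by apply: facl; rewrite finite_setU; split.
  apply: bigcup_finite => [|k _]; first exact: finite_finset.
  by apply: facl; exact: finite_dom.
pose t : Aut M := letter_val h l.
have [s Es nZ] : exists2 s, pointwise_stabilizer E s & ~ Z (t (s y)).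
  apply: contrapT => nex; apply: ncl.
  apply: sub_finite_set (finite_image (aut_fun t^-1) fZ) => _ [s Es <-].
  exists (t (s y)); last exact: autK.
  by apply: contrapT => nZ; apply: nex; exists s.
pose t' : Aut M := t * s; pose z := t' y.
pose h' i : Aut M := if i == l.1 then (if l.2 then t' else t'^-1) else h i.
pose D' i := if i == l.1 then (if l.2 then y |` D i else z |` D i) else D i.
have lh' : letter_val h' l = t'.
  by rewrite /letter_val /h' eqxx; case: l.2; rewrite ?invgK.
(* On the prescribed points the inserted s acts trivially. *)
have agr : agree D h h'.
  move=> i x Dx; rewrite /h'; case: eqP => // il.
  move: Dx Es; rewrite il /t' /t /E /dom /letter_val; case: l.2 => Dx Es.
    by rewrite autME Es.
  by rewrite invgM invgK autME (pointwise_stabilizerV Es)//; exists x.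
have domE : dom h' D' l = y |` E.
  rewrite /E /dom /D' eqxx; case lb: l.2 => //.
  rewrite image_setU image_set1; congr (_ `|` _).
    by rewrite /h' eqxx lb /z autK.
  by apply/seteqP; split=> _ [x Dx <-]; exists x => //; rewrite agr.
exists h', D'; split.
  rewrite /step lh'; split=> //.
  - by move=> i; rewrite /D'; case: eqP => // _; case: l.2; rewrite finite_setU.
  - by move=> i x Dx; rewrite /D'; case: eqP => // _; case: l.2; right.
  - by rewrite domE; left.
  - by move=> Xz; apply: nZ; left; left.
move=> k kl; rewrite /step lh'; have [kE|kE] := eqVneq k.1 l.1; last first.
  rewrite (@dom_eq h' h D' D k) /D' /h' ?(negPf kE)// => clz.
  by apply: nZ; right; exists k.
have -> : k = l.
  case: k l kE kl {ncl E fE Z fZ t Es nZ t' z h' D' lh' agr domE} =>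
    i b [j c] /= ->.
  by rewrite /letter_inv /=; case: b c => [] [] //; rewrite eqxx.
by rewrite domE => clz; apply: nZ; left; right.
Qed.

(** Iterates [fresh_step]: at each point reached, the next letter of a reduced
    word is not the one leading back, hence is again free. *)
Lemma free_path h D l w y (X : set M) :
  finite_acl M -> (forall i, finite_set (D i)) -> finite_set X ->
  ~ acl (dom h D l) y -> reduced (l :: w) ->
  exists h' D',
    [/\ forall i, finite_set (D' i), forall i, D i `<=` D' i, agree D h h',
        ~ X (walk h' (l :: w) y) &
        forall g, agree D' h' g ->
          walk g (l :: w) y = walk h' (l :: w) y] /\
    forall k, k != letter_inv (last l w) ->
      ~ acl (dom h' D' k) (walk h' (l :: w) y).
Proof.
move=> facl; elim: w h D l y => [|k w IHw] h D l y fD fX ncl rw.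
  have [h' [D' [[fD' DD' hh' ly Xz] ncl']]] := fresh_step facl fD fX ncl.
  exists h', D'; split=> //; split=> // g gh'.
  exact: (agree_step gh' ly).
have [h1 [D1 [[fD1 DD1 hh1 ly _] ncl1]]] :=
  fresh_step facl fD (finite_set0 _) ncl.
move: rw => /= /andP[kl rw].
have [h' [D' [[fD' D1D' h1h' Xz rec] ncl']]] :=
  IHw _ _ _ _ fD1 fX (ncl1 k kl) rw.
have ry g : agree D1 h1 g -> step g l y = step h1 l y.
  by move=> h1g; exact: (agree_step h1g ly).
have vE g : agree D1 h1 g ->
    walk g (l :: k :: w) y = walk g (k :: w) (step h1 l y).
  by move=> /ry <-.
exists h', D'; rewrite vE//; split=> //; split=> //.
- by move=> i; apply: subset_trans (DD1 i) _.
- exact: agree_trans hh1 h1h'.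
- by move=> g gh'; rewrite vE ?rec//; exact: agree_trans h1h' gh'.
Qed.

Definition walk_orbit h (a : M) : set M :=
  [set walk h w a | w in [set: seq (letter n)]].

(** Were there no such v and l, every step of every walk from a would be
    prescribed, and all the points reached would lie in B. *)
Lemma exit_path h B a : (1 <= n)%N -> finite_set B -> acl B `<=` B ->
  ~ finite_set (walk_orbit h a) ->
  exists v l,
    (forall g, agree (fun=> B) h g -> walk g v a = walk h v a) /\
    ~ acl (dom h (fun=> B) l) (walk h v a).
Proof.
move=> n_gt0 fB clB inf; apply: contrapT => nex; apply: inf.
pose D (i : 'I_n) := B.
have cldom l : acl (dom h D l) `<=` dom h D l.
  rewrite /dom; case: l.2 => // x /acl_image[y /clB By <-]; by exists y.
pose rec v := forall g, agree D h g -> walk g v a = walk h v a.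
have inD v l : rec v -> dom h D l (walk h v a).
  by move=> rv; apply: cldom; apply: contrapT => ncl; apply: nex; exists v, l.
have recT v : rec v.
  elim/last_ind: v => // v l rv g hg; rewrite -cats1 !walk_cat rv//.
  by apply: (agree_step hg); exact: inD.
apply: sub_finite_set fB => _ [v _ <-].
exact: (inD v (Ordinal n_gt0, true)).
Qed.

(** L is chosen before w, so that w can then be taken from a sequence whose k-th
    word is known to fix the ends of the walks of length at most k only. *)
Lemma moving_extension h B a : (1 <= n)%N -> finite_acl M -> finite_set B ->
  ~ finite_set (walk_orbit h a) ->
  exists L, forall w, reduced w -> w != [::] -> exists g v,
    [/\ agree (fun=> B) h g, (size v <= L)%N &
        walk g w (walk g v a) <> walk g v a].
Proof.
move=> n_gt0 facl fB inf; have fC := facl _ fB.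
(* Closing B first makes an unprescribed step also non-algebraic. *)
have [v [l [rv ncl]]] := exit_path n_gt0 fC (acl_idem fC) inf.
exists (size v + 2)%N => w rw w0.
have [u [k [w' [ru su rw' ww' kl]]]] := reduced_escape l rw w0.
have [h1 [D1 [[fD1 CD1 hh1 _ rec] ncl1]]] :=
  free_path facl (fun=> fC) (finite_set0 _) ncl ru.
set y := walk h v a in ncl rec ncl1.
set z := walk h1 (l :: u) y in ncl1.
have [g [D2 [[_ D12 h1g zg _] _]]] :=
  free_path facl fD1 (finite_set1 z) (ncl1 k kl) rw'.
have hg : agree (fun=> acl B) h g by exact: agree_trans hh1 h1g.
have gz : walk g (v ++ l :: u) a = z.
  by rewrite walk_cat rv// rec.
exists g, (v ++ l :: u); rewrite size_cat leq_add2l gz; split=> //.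
  by move=> i x Bx; apply: hg; exact: sub_acl.
case: ww' => E; first by rewrite -E.
by move=> wz; apply: zg; rewrite /= E -[in LHS]wz walk_inv.
Qed.

End Conditions.

(** * Neighbourhoods in Aut M and meager sets *)

Section Topology.
Context {M : structure} {n : nat}.
Implicit Types (s t : Aut M) (h g : {ptws 'I_n -> Aut M}) (a x : M).

Lemma nbhs_aut_finite s (U : set (Aut M)) : nbhs s U ->
  exists2 A : set M, finite_set A &
    forall t, (forall a, A a -> t a = s a) -> U t.
Proof.
pose F : set_system (Aut M) := [set V | exists2 A : set M, finite_set A &
  forall t, (forall a, A a -> t a = s a) -> V t].
have FF : Filter F.
  split; first by exists set0.
    move=> V W [A fA AV] [B fB BW]; exists (A `|` B).
      by rewrite finite_setU.
    move=> t AB; split; [apply: AV | apply: BW] => a ?; apply: AB.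
      by left.
    by right.
  by move=> V W VW [A fA AV]; exists A => // t /AV/VW.
suff : F --> s by apply.
by apply: aut_cvgP => a; exists [set a] => // t; exact.
Qed.

Lemma nbhs_aut_agree s (A : set M) : finite_set A ->
  nbhs s [set t : Aut M | forall a, A a -> t a = s a].
Proof.
move=> /(@finite_seqP {classic M})[r ->].
have near_list : nbhs s [set t : Aut M | forall i : 'I_(size r),
    t (tnth (in_tuple r) i) = s (tnth (in_tuple r) i)].
  exact: (@filter_forall _ _ _ _ (nbhs_filter s) (fun i => aut_eval_nbhs s _)).
apply: (@filterS _ _ (nbhs_filter s)) near_list => t tr a /= ar.
by have [i ->] := tnthP (in_tuple r) a ar; exact: tr.
Qed.

Lemma nbhs_tuple_finite g (U : set {ptws 'I_n -> Aut M}) : nbhs g U ->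
  exists2 B : set M, finite_set B & forall h, agree (fun=> B) g h -> U h.
Proof.
pose F : set_system {ptws 'I_n -> Aut M} :=
  [set V | exists2 B : set M, finite_set B &
    forall h, agree (fun=> B) g h -> V h].
have FF : Filter F.
  split; first by exists set0.
    move=> V W [A fA AV] [B fB BW]; exists (A `|` B).
      by rewrite finite_setU.
    move=> t AB; split; [apply: AV | apply: BW] => i a ?; apply: AB.
      by left.
    by right.
  by move=> V W VW [A fA AV]; exists A => // t /AV/VW.
suff : F --> g by apply.
apply/cvg_sup => i V [_ [[W oW <-] Wg WV]].
have [A fA AW] := nbhs_aut_finite (open_nbhs_nbhs (conj oW Wg)).
by exists A => // h gh; apply/WV/AW => a; exact: gh.
Qed.

Lemma nbhs_walk g w x : nbhs g [set h | walk h w x = walk g w x].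
Proof.
elim: w x => [|l w IHw] x.
  by apply: (@filterS _ (nbhs g) _ setT) => //; exact: filterT.
have : nbhs g [set h | step h l x = step g l x].
  have pc (i : 'I_n) :
      {for g, continuous (fun h : {ptws 'I_n -> Aut M} => h i)}.
    exact: (@proj_continuous _ (fun=> Aut M) i g).
  case: l => i [].
    exact: (pc i _ (aut_eval_nbhs (g i) x)).
  exact: (continuous_comp (pc i) (@invg_continuous (Aut M) (g i))
            (aut_eval_nbhs (g i)^-1 x)).
move=> stepE; have walkE := IHw (step g l x).
apply: (@filterS2 _ _ (nbhs_filter g)) walkE stepE => h /= wE sE.
by rewrite !walk_cons sE.
Qed.

Definition almost_fixing (W : nat -> seq (letter n)) a (K : nat) :
    set {ptws 'I_n -> Aut M} :=
  [set g | ~ finite_set (walk_orbit g a) /\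
    forall k v, (K <= k)%N -> (size v <= k)%N ->
    walk g (W k) (walk g v a) = walk g v a].

(** For each k and v the fixing condition depends only on finitely many values
    of the tuple, so it passes to the closure; the infinite orbit does not, and
    is used only for one tuple g inside the supposed open set. *)
Lemma nowhere_dense_almost_fixing (W : nat -> seq (letter n)) a K :
  (1 <= n)%N -> finite_acl M -> (forall k, reduced (W k) /\ W k != [::]) ->
  nowhere_dense (almost_fixing W a K).
Proof.
move=> n_gt0 facl rW; apply/seteqP; split=> // g0 Ug0.
have [g [[inf _]]] := nbhs_singleton Ug0 _ (nbhs_interior Ug0).
move=> /nbhs_tuple_finite[B fB Bcl].
have [L mov] := moving_extension n_gt0 facl fB inf.
have [rw w0] := rW (maxn K L).
have [h [v [gh vL neq]]] := mov _ rw w0.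
have nearh := @filterI _ _ (nbhs_filter (h : {ptws 'I_n -> Aut M})) _ _
  (nbhs_walk h v a) (nbhs_walk h (W (maxn K L)) (walk h v a)).
have [h' [[_ fixed] [vE wE]]] := Bcl h gh _ nearh.
apply: neq; rewrite -wE -vE; apply: fixed; first exact: leq_maxl.
by rewrite leq_max vL orbT.
Qed.

End Topology.

(** Sets indexed by a countable type are reindexed along an injection into nat;
    the numbers outside its image get the empty set. *)
Lemma meager_bigcup (T : topologicalType) (I : Type) (F : I -> set T)
    (A : set T) :
  countable [set: I] -> (forall i, nowhere_dense (F i)) ->
  A `<=` \bigcup_i F i -> meager A.
Proof.
move=> /countable_injP[c cinj] nF AF.
exists (fun j => \bigcup_(i in [set i | c i = j]) F i) => [j|x /AF[i _ Fx]].
  have [[i ci]|ni] := pselect (exists i, c i = j).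
    suff -> : \bigcup_(i in [set i | c i = j]) F i = F i by [].
    apply/seteqP; split=> [x [k /= ck Fk]|x Fx]; last by exists i.
    by rewrite (cinj i k) ?inE ?ci ?ck.
  rewrite bigcup0 => [|i ci]; last by exfalso; apply: ni; exists i.
  by rewrite /nowhere_dense closure0 interior0.
by exists (c i) => //; exists i.
Qed.

(** * Precompact and discrete generated subgroups *)

Lemma walk_orbitE (M : structure) (n : nat) (f : 'I_n -> Aut M) (a : M) :
  walk_orbit f a = [set aut_fun s a | s in generated f].
Proof.
apply/seteqP; split=> [_ [w _ <-]|_ [s /generatedP[w ->] <-]].
  by exists (word_val f w) => //; apply/generatedP; exists w.
by exists w.
Qed.

(** An ultrafilter on the closure of <f> selects, for each point a, one value
    of s a and one value of s^-1 a among the finitely many in the orbit of a.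
    The two functions so obtained are inverse to each other, and the first is an
    automorphism because each instance of the conditions involves only finitely
    many points, at which some s of the closure agrees with it. *)
Lemma precompact_generated (M : structure) (n : nat) (f : 'I_n -> Aut M) :
  (forall a, finite_set (walk_orbit f a)) -> precompact (generated f).
Proof.
move=> forb; rewrite precompactE compact_ultra => F UF Fcl.
have clorb (s : Aut M) a : closure (generated f) s ->
    walk_orbit f a (s a) /\ walk_orbit f a (aut_fun s^-1 a).
  move=> cls; rewrite walk_orbitE; split.
    by have [t [ft <-]] := cls _ (aut_eval_nbhs s a); exists t.
  have [t [ft /= ta]] := cls _ (aut_eval_nbhs s (aut_fun s^-1 a)).
  exists t^-1; first exact: generatedV.
  by rewrite -[in LHS](autVK s a) -ta autK.
have pick (e : Aut M -> M) (O : set M) : finite_set O ->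
    F [set s | O (e s)] -> exists y, F [set s | e s = y].
  move=> /(@finite_seqP {classic M})[r ->]; elim: r => [|y r IHr] FO.
    by exfalso; apply: (@filter_not_empty _ F); apply: filterS FO.
  have [Fy|nFy] := in_ultra_setVsetC [set s | e s = y] UF; first by exists y.
  apply: IHr; apply: filterS (filterI nFy FO) => s [ny] /=.
  by rewrite inE => /orP[/eqP|].
have /choice[p Fp] a : exists y, F [set s : Aut M | s a = y].
  by apply: (pick _ _ (forb a)); apply: filterS Fcl => s /(clorb s a)[].
have /choice[q Fq] a : exists y, F [set s : Aut M | aut_fun s^-1 a = y].
  by apply: (pick _ _ (forb a)); apply: filterS Fcl => s /(clorb s a)[].
have pf k (x : 'I_k -> M) : F [set s : Aut M | s \o x = p \o x].
  apply: (@filterS _ F _ _ _ _ (@filter_forall _ _ _ F _ (fun i => Fp (x i)))).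
  by move=> s sx; apply/funext.
have pA : automorphism (p : self_maps M).
  split.
  - exists q => a.
      have [s [/= sa]] := filter_ex (filterI (Fp a) (Fq (p a))).
      by move=> <-; rewrite -sa autK.
    have [s [/= sa]] := filter_ex (filterI (Fq a) (Fp (q a))).
    by move=> <-; rewrite -sa autVK.
  - move=> R x; have [s /= <-] := filter_ex (pf _ x).
    by have [_ sR _] := autP s; exact: sR.
  - move=> G x.
    have [s [/= <- <-]] := filter_ex (filterI (Fp (fun_interp x)) (pf _ x)).
    by have [_ _ sF] := autP s; exact: sF.
have cv : F --> mk_aut pA by apply: aut_cvgP => a; exact: Fp.
exists (mk_aut pA); split=> //; apply: closed_closure => U /cv FU.
exact: filter_ex (filterI Fcl FU).
Qed.

(** Two elements of <f> that agree on A are equal under this hypothesis, so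
    every singleton is open. *)
Lemma discrete_generated (M : structure) (n : nat) (f : 'I_n -> Aut M)
    (A : set M) :
  finite_set A ->
  (forall s, generated f s -> pointwise_stabilizer A s -> s = 1) ->
  discrete_subset (generated f).
Proof.
move=> fA triv U; rewrite openE => u Uu.
have cv := @initial_continuous (generated f) (Aut M) set_val u.
have near_u := cv _ (nbhs_aut_agree (set_val u) fA).
apply: (@filterS _ _ (nbhs_filter u)) near_u => t /= tu.
have ut : (set_val u)^-1 * set_val t = 1.
  apply: triv => [|a Aa]; last by rewrite autME tu// autK.
  by apply: generatedM; [apply: generatedV|]; exact: set_valP.
suff -> : t = u by [].
by apply/val_inj/(mulgI (set_val u)^-1); rewrite ut mulVg.
Qed.

Lemma reduced_stabilizing_word (M : structure) (n : nat) (f : 'I_n -> Aut M)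
    (A : set M) : ~ discrete_subset (generated f) -> finite_set A ->
  exists w, [/\ reduced w, w != [::] & forall a, A a -> walk f w a = a].
Proof.
move=> ndis fA; apply: contrapT => nex; apply: ndis.
apply: (discrete_generated fA) => s /generatedP[w ->] sA.
have [w' rw' wE] := reduced_word_exists f w.
have [w0|w0] := eqVneq w' [::]; first by rewrite -wE w0.
by exfalso; apply: nex; exists w'; split=> // a /sA; rewrite -wE.
Qed.

(** * Similar tuples *)

Lemma continuous_stabilizer (M : structure) (H : set (Aut M))
    (phi : Aut M -> Aut M) (a : M) :
  H 1 -> phi 1 = 1 -> {within H, continuous phi} ->
  exists2 A, finite_set A &
    forall s, H s -> pointwise_stabilizer A s -> phi s a = a.
Proof.
move=> H1 phi1 /subspace_continuousP/(_ 1 H1 _ (aut_eval_nbhs (phi 1) a)).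
move=> /nbhs_aut_finite[A fA As]; exists A => // s Hs sA.
by have := As s sA Hs; rewrite /= phi1.
Qed.

Section Similarity.
Context {M : structure} {n : nat}.
Implicit Types (f g : 'I_n -> Aut M).

(** On words, this is continuity at 1 of the map <f> -> <g>, f i |-> g i; it
    also entails that the map is well defined. *)
Definition controls f g := forall a, exists2 A : set M, finite_set A &
  forall w, (forall b, A b -> walk f w b = b) -> walk g w a = a.

Lemma similarity_controls f g :
  similarity_class f g -> controls f g /\ controls g f.
Proof.
move=> [phi [psi [phif [[fun_phi inj_phi surj_phi] phiK phiM cphi cpsi]]]].
have gen (k : 'I_n -> Aut M) w : generated k (word_val k w).
  by apply/generatedP; exists w.
have phiM' s t : generated f s -> generated f t -> phi (s * t) = phi s * phi t.
  by move=> ? ?; apply: phiM; rewrite inE.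
have phi1 : phi 1 = 1.
  apply: (mulgI (phi 1)); rewrite -phiM' ?mulg1//; exact: generated1.
have fl l : generated f (letter_val f l).
  by have := gen f [:: l]; rewrite /= mul1g.
have phil l : phi (letter_val f l) = letter_val g l.
  case: l => i []; first exact: phif.
  have := phiM' _ _ (fl (i, true)) (fl (i, false)).
  rewrite /letter_val /= mulgV phi1 phif => gphi.
  by apply: (mulgI (g i)); rewrite mulgV.
have phiw w : phi (word_val f w) = word_val g w.
  by elim: w => [//|l w IHw] /=; rewrite phiM'// IHw phil.
have psiw w : psi (word_val g w) = word_val f w by rewrite -phiw phiK ?inE.
split=> a.
  have [A fA As] := continuous_stabilizer a (@generated1 _ _ f) phi1 cphi.
  by exists A => // w wA; rewrite /walk -phiw; apply: As => //; exact: gen.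
have [A fA As] := continuous_stabilizer a (@generated1 _ _ g) (psiw [::]) cpsi.
by exists A => // w wA; rewrite /walk -psiw; apply: As => //; exact: gen.
Qed.

(** The value of a word at g on the point a depends only on its value at f on a
    suitable finite set A, for which there are finitely many possibilities. *)
Lemma controls_finite_orbit f g : controls f g ->
  (forall a, finite_set (walk_orbit f a)) ->
  forall a, finite_set (walk_orbit g a).
Proof.
move=> fg forb a; have [A fA fixA] := fg a.
apply: (@finite_image_agreement _ _ _ _ _ (walk f) _ _ fA) => [b _|w _].
  exact: forb.
apply: sub_finite_set (finite_set1 (walk g w a)) => _ [v [_ vw] <-] /=.
rewrite -[in RHS](fixA (v ++ word_inv w)) ?walk_cat ?walk_invK// => b Ab.
by rewrite walk_cat vw// walk_inv.
Qed.

End Similarity.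

Theorem theorem4p4 (M : structure)
    (countableM : countable [set: M])
    (locfinM : locally_finite M)
    (finite_aclM : forall A : set M, finite_set A -> finite_set (acl A))
    (n : nat) (n_ge1 : (1 <= n)%N) (f : 'I_n -> Aut M) :
  precompact (generated f) \/
  discrete_subset (generated f) \/
  meager (similarity_class f).
Proof.
have [forb|inf] := pselect (forall a, finite_set (walk_orbit f a)).
  by left; exact: precompact_generated.
right; have [dis|ndis] := pselect (discrete_subset (generated f)).
  by left.
right; have [c cinj] := elimT (@countable_injP M setT) countableM.
have ncode k : finite_set [set b | (c b <= k)%N].
  have -> : [set b | (c b <= k)%N] = c @^-1` `I_k.+1 by [].
  by apply: finite_preimage => // x y _ _; apply: cinj; rewrite inE.
have /choice[W Wk] k : exists w, [/\ reduced w, w != [::] & forall b v,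
    (c b <= k)%N -> (size v <= k)%N -> walk f w (walk f v b) = walk f v b].
  have fP := finite_image2 (walk f) (@finite_short_words n k) (ncode k).
  have [w [rw w0 wfix]] := reduced_stabilizing_word ndis fP.
  by exists w; split=> // b v bk vk; apply: wfix; exists v => //; exists b.
apply: (@meager_bigcup _ (M * nat)%type
  (fun aK => almost_fixing W aK.1 aK.2)) => [|[a K]|g gf].
- by rewrite -setXTT; exact: countableX.
- by apply: nowhere_dense_almost_fixing => // k; have [] := Wk k.
have [fg gf'] := similarity_controls gf.
have [a ainf] : exists a, ~ finite_set (walk_orbit g a).
  apply: contrapT => nex; apply/inf/(controls_finite_orbit gf') => a.
  by apply: contrapT => ainf; apply: nex; exists a.
have [A fA fixA] := fg a.
have [K cK] : exists K, forall b, A b -> (c b <= K)%N.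
  have [r rA] := (@finite_seqP {classic M} A).1 fA.
  exists (\max_(b <- (r : seq {classic M})) c b)%N => b; rewrite rA => br.
  exact: leq_bigmax_seq.
exists (a, K) => //; split=> // k v Kk vk.
(* The word v, W k, v^-1 stabilizes A at f, hence fixes a at g. *)
apply: (can_inj (walk_invK g v)); rewrite walk_inv -!walk_cat.
apply: fixA => b Ab.
have [_ _ Wfix] := Wk k.
rewrite !walk_cat Wfix ?walk_inv//; exact: leq_trans (cK b Ab) Kk.
Qed.
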